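(* Let $\alpha$ be a badly approximable real number, i.e. $\inf_{q\ge 1} q\,\|q\alpha\|>0$. Then the set of real numbers $\beta$ such that $$\liminf_{q\to+\infty}\, q\,(\log q)^2\,\|q\alpha\|\,\|q\beta\|>0$$ (where $q$ runs over positive integers) has Hausdorff dimension $1$.
   Context: For a real number $x$, $\|x\|$ denotes the distance from $x$ to the nearest integer. *)

(* Defs.v *)
From Stdlib Require Import Reals Lra.
Open Scope R_scope.

(* ||x|| : distance from x to the nearest integer.
   frac x = x - floor x, where floor x = up x - 1 (up x is the unique integer
   with x < up x <= x + 1). *)
Definition frac_part (x : R) : R := x - (IZR (up x) - 1).
Definition dnint (x : R) : R := Rmin (frac_part x) (1 - frac_part x).

Definition badly_approximable (a : R) : Prop :=
  exists c : R, 0 < c /\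
    forall q : nat, (1 <= q)%nat -> c <= INR q * dnint (INR q * a).

Definition liminf_pos (u : nat -> R) : Prop :=
  exists c : R, 0 < c /\ exists N : nat, forall q : nat, (N <= q)%nat -> c <= u q.

(* Diameter of a subset of R: d = sup {|x - y| : x, y in U}, with diam(empty) = 0.
   A set has a (finite) diameter iff it is bounded. *)
Definition is_diam (U : R -> Prop) (d : R) : Prop :=
  0 <= d /\
  (forall x y, U x -> U y -> Rabs (x - y) <= d) /\
  (forall b, 0 <= b -> (forall x y, U x -> U y -> Rabs (x - y) <= b) -> d <= b).

(* d^s for s > 0, with the convention 0^s = 0. *)
Definition powd (d s : R) : R := if Rle_dec d 0 then 0 else Rpower d s.

Definition hausdorff_null (s : R) (E : R -> Prop) : Prop :=
  forall delta eps : R, 0 < delta -> 0 < eps ->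
    exists (U : nat -> R -> Prop) (d : nat -> R),
      (forall x, E x -> exists i, U i x) /\
      (forall i, is_diam (U i) (d i) /\ d i <= delta) /\
      exists l, infinite_sum (fun i => powd (d i) s) l /\ l <= eps.

Definition is_glb (S : R -> Prop) (m : R) : Prop :=
  (forall s, S s -> m <= s) /\ (forall b, (forall s, S s -> b <= s) -> b <= m).

Definition hausdorff_dim (E : R -> Prop) (dim : R) : Prop :=
  is_glb (fun s => 0 < s /\ hausdorff_null s E) dim.

(* Main.v *)
(* Cantor-type construction on the tree of dyadic intervals of [0, 1], after Peres and Schlag.
   Write c for the infimum of q ||q alpha||, let 2^m <= q < 2^(m+1), and let 2^(-n) be comparable
   to eps / (q^2 m^2 ||q alpha||).  At level n delete the dyadic intervals of length 2^(-n) that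
   come within 2^(-n) of some p/q.  As alpha is badly approximable, only O(eps 2^(n-m) / m^2)
   integers q correspond to given (m, n), and each of them deletes O(1) intervals below every
   surviving interval of level m.  Since n <= 3 m, summing over m shows that the number W_n of
   survivors satisfies n W_n >= 2 (n - 1) W_(n-1), hence W_n >= 2^n / n.

   For s < 1 there is room left: if the set were H^s-null, a cover by sets U_i with
   sum (diam U_i)^s <= 1 has at most 2^((n+1)s) members of diameter about 2^(-n), so the
   intervals meeting the U_i can be deleted as well without spoiling the recurrence.  A point
   in the resulting Cantor set belongs to the set and to none of the U_i. *)
Require Import Defs.
From Stdlib Require Import Reals Lra Lia ZArith List Classical ClassicalEpsilon.
Import ListNotations.
Open Scope R_scope.

(** * Distance to the nearest integer, and arithmetic of powers of two *)

Lemma dnint_le_dist (x : R) (p : Z) : dnint x <= Rabs (x - IZR p).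
Proof.
  unfold dnint, Defs.frac_part.
  destruct (archimed x) as [H1 H2].
  destruct (Z_le_gt_dec (up x) p) as [H | H].
  - apply IZR_le in H.
    eapply Rle_trans; [apply Rmin_r |].
    rewrite Rabs_left1; lra.
  - assert (H' : (p <= up x - 1)%Z) by lia.
    apply IZR_le in H'; rewrite minus_IZR in H'.
    eapply Rle_trans; [apply Rmin_l |].
    rewrite Rabs_right; lra.
Qed.

Lemma dnint_attained (x : R) : exists p : Z, Rabs (x - IZR p) = dnint x.
Proof.
  unfold dnint, Defs.frac_part.
  destruct (archimed x) as [H1 H2].
  unfold Rmin; destruct Rle_dec as [H | H].
  - exists (up x - 1)%Z; rewrite minus_IZR, Rabs_right; lra.
  - exists (up x); rewrite Rabs_left1; lra.
Qed.

Lemma dnint_ge0 (x : R) : 0 <= dnint x.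
Proof. destruct (dnint_attained x) as [p <-]; apply Rabs_pos. Qed.

Lemma dnint_le1 (x : R) : dnint x <= 1.
Proof.
  unfold dnint, Defs.frac_part; destruct (archimed x) as [H1 H2].
  eapply Rle_trans; [apply Rmin_l | lra].
Qed.

Lemma up_le (x y : R) : x <= y -> (up x <= up y)%Z.
Proof.
  intros H; destruct (archimed x), (archimed y).
  apply Z.lt_succ_r, lt_IZR; unfold Z.succ; rewrite plus_IZR; lra.
Qed.

Lemma Zdiv2_pow_succ (j : Z) (k : nat) :
  (j / 2 ^ Z.of_nat (S k) = j / 2 / 2 ^ Z.of_nat k)%Z.
Proof.
  rewrite Nat2Z.inj_succ, Z.pow_succ_r by lia.
  rewrite Z.div_div by lia; reflexivity.
Qed.

Lemma IZR_pow2 (k : nat) : IZR (2 ^ Z.of_nat k) = 2 ^ k.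
Proof. rewrite <- pow_IZR; reflexivity. Qed.

Lemma pow2_pos (n : nat) : 0 < 2 ^ n.
Proof. apply pow_lt; lra. Qed.

(** * Counting by covering lists and by separation *)

(** Cardinality bounds take the form of a short list containing every relevant element;
    concatenating such lists gives the union bound. *)
Lemma finite_union_bound {I A : Type} (Q : I -> A -> Prop) (l : list I) (b : R) :
  (forall i, In i l -> exists C, (forall a, Q i a -> In a C) /\ INR (length C) <= b) ->
  exists C, (forall i a, In i l -> Q i a -> In a C) /\ INR (length C) <= INR (length l) * b.
Proof.
  induction l as [| i l IH]; intros H.
  - exists []; split; [intros i a [] | simpl; lra].
  - destruct (H i (or_introl eq_refl)) as [C1 [HC1 Hl1]].
    destruct (IH (fun x hx => H x (or_intror hx))) as [C2 [HC2 Hl2]].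
    exists (C1 ++ C2); split.
    + intros i' a [<- | Hi] Ha; apply in_or_app; [left; auto | right; eauto].
    + cbn [length]; rewrite length_app, plus_INR, S_INR; lra.
Qed.

(** Pigeonhole: [up (t a / sigma)] is injective on separated points, and its values are integers
    between [up (- (D / sigma))] and [up (D / sigma)]. *)
Lemma separated_length {A : Type} (t : A -> R) (l : list A) (D sigma : R) :
  0 < sigma -> 0 <= D -> NoDup l ->
  (forall a, In a l -> Rabs (t a) <= D) ->
  (forall a b, In a l -> In b l -> a <> b -> sigma <= Rabs (t a - t b)) ->
  INR (length l) <= 2 * D / sigma + 2.
Proof.
  intros Hs HD Hnd Hb Hsep.
  set (g := fun a => up (t a / sigma)).
  set (lo := up (- (D / sigma))); set (hi := up (D / sigma)).
  set (target := map (fun k => (lo + Z.of_nat k)%Z) (seq 0 (Z.to_nat (hi - lo + 1)))).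
  assert (Hlohi : (lo <= hi)%Z).
  { apply up_le; assert (0 <= D / sigma) by (apply Rle_mult_inv_pos; lra); lra. }
  assert (Hlen : (length (map g l) <= length target)%nat).
  { apply NoDup_incl_length.
    - apply NoDup_map_NoDup_ForallPairs; [| exact Hnd].
      intros a b Ha Hb' Hab; apply NNPP; intros Hne.
      specialize (Hsep a b Ha Hb' Hne).
      unfold g in Hab.
      destruct (archimed (t a / sigma)) as [A1 A2].
      destruct (archimed (t b / sigma)) as [B1 B2].
      rewrite Hab in A1, A2.
      assert (Hlt : Rabs (t a / sigma - t b / sigma) < 1) by (apply Rabs_def1; lra).
      replace (t a / sigma - t b / sigma) with ((t a - t b) / sigma) in Hlt by (field; lra).
      unfold Rdiv in Hlt; rewrite Rabs_mult, (Rabs_right (/ sigma)) in Hlt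
        by (apply Rle_ge, Rlt_le, Rinv_0_lt_compat; lra).
      apply (Rmult_lt_compat_r sigma) in Hlt; [| lra].
      rewrite Rmult_assoc, Rinv_l, Rmult_1_r in Hlt by lra; lra.
    - intros z Hz; apply in_map_iff in Hz as [a [<- Ha]].
      specialize (Hb a Ha).
      pose proof (Rle_abs (t a)); pose proof (Rle_abs (- t a)) as Hn; rewrite Rabs_Ropp in Hn.
      assert (L1 : (lo <= g a)%Z).
      { apply up_le; unfold Rdiv; rewrite Ropp_mult_distr_l.
        apply Rmult_le_compat_r; [apply Rlt_le, Rinv_0_lt_compat; lra | lra]. }
      assert (L2 : (g a <= hi)%Z).
      { apply up_le; unfold Rdiv.
        apply Rmult_le_compat_r; [apply Rlt_le, Rinv_0_lt_compat; lra | lra]. }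
      apply in_map_iff; exists (Z.to_nat (g a - lo)); split; [lia |].
      apply in_seq; lia. }
  unfold target in Hlen; rewrite !length_map, length_seq in Hlen.
  apply le_INR in Hlen; rewrite (INR_IZR_INZ (Z.to_nat _)), Z2Nat.id in Hlen by lia.
  rewrite plus_IZR, minus_IZR in Hlen.
  destruct (archimed (D / sigma)) as [_ A2]; fold hi in A2.
  destruct (archimed (- (D / sigma))) as [B1 _]; fold lo in B1.
  unfold Rdiv in *; lra.
Qed.

(** * The dyadic tree and the growth of its survivors *)

(* An integer [j] at level [n] stands for the closed interval [j / 2 ^ n, (j + 1) / 2 ^ n]. *)
Fixpoint survivors (P : nat -> Z -> Prop) (n : nat) : list Z :=
  match n with
  | O => [0%Z]
  | S k => filter (fun j => if excluded_middle_informative (P (S k) j) then false else true)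
             (flat_map (fun j => [2 * j; 2 * j + 1]%Z) (survivors P k))
  end.

Lemma in_children (j : Z) (l : list Z) :
  In j (flat_map (fun i => [2 * i; 2 * i + 1]%Z) l) <-> In (j / 2)%Z l.
Proof.
  rewrite in_flat_map; split.
  - intros [i [Hi [<- | [<- | []]]]].
    + now replace (2 * i / 2)%Z with i by (symmetry; rewrite Z.mul_comm; apply Z.div_mul; lia).
    + now replace ((2 * i + 1) / 2)%Z with i by (apply (Z.div_unique _ _ _ 1); lia).
  - intros H; exists (j / 2)%Z; split; [exact H |].
    pose proof (Z.div_mod j 2 ltac:(lia)); pose proof (Z.mod_pos_bound j 2 ltac:(lia)).
    assert (Hj : (2 * (j / 2) = j \/ 2 * (j / 2) + 1 = j)%Z) by lia.
    destruct Hj as [Hj | Hj]; [now left | now right; left].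
Qed.

Lemma in_survivors_succ (P : nat -> Z -> Prop) (n : nat) (j : Z) :
  In j (survivors P (S n)) <-> In (j / 2)%Z (survivors P n) /\ ~ P (S n) j.
Proof.
  cbn [survivors]; rewrite filter_In, in_children.
  destruct excluded_middle_informative; intuition discriminate.
Qed.

Lemma NoDup_children (l : list Z) :
  NoDup l -> NoDup (flat_map (fun i => [2 * i; 2 * i + 1]%Z) l).
Proof.
  induction 1 as [| i l Hi Hl IH]; [constructor |].
  cbn [flat_map app].
  constructor; [| constructor; [| exact IH]].
  - intros [H | H]; [lia |].
    apply in_children in H.
    now replace (2 * i / 2)%Z with i in H by (symmetry; rewrite Z.mul_comm; apply Z.div_mul; lia).
  - intros H; apply in_children in H.
    now replace ((2 * i + 1) / 2)%Z with i in H by (apply (Z.div_unique _ _ _ 1); lia).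
Qed.

Lemma survivors_NoDup (P : nat -> Z -> Prop) (n : nat) : NoDup (survivors P n).
Proof.
  induction n as [| n IH]; cbn [survivors].
  - constructor; [intros [] | constructor].
  - apply NoDup_filter, NoDup_children, IH.
Qed.

Lemma survivors_ancestor (P : nat -> Z -> Prop) (k n : nat) (j : Z) :
  In j (survivors P (n + k)) -> In (j / 2 ^ Z.of_nat k)%Z (survivors P n).
Proof.
  revert j; induction k as [| k IH]; intros j H.
  - rewrite Nat.add_0_r in H; simpl; now rewrite Z.div_1_r.
  - rewrite Nat.add_succ_r in H; apply in_survivors_succ in H as [H _].
    rewrite Zdiv2_pow_succ; now apply IH.
Qed.

(** There are twice as many children as parents, and the deleted children form a duplicate-free list
    contained in [C]. *)
Lemma survivors_length_succ (P : nat -> Z -> Prop) (n : nat) (C : list Z) :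
  (forall j, In (j / 2)%Z (survivors P n) -> P (S n) j -> In j C) ->
  2 * INR (length (survivors P n)) <= INR (length (survivors P (S n))) + INR (length C).
Proof.
  intros HC.
  set (ch := flat_map (fun i => [2 * i; 2 * i + 1]%Z) (survivors P n)).
  set (keep := fun j => if excluded_middle_informative (P (S n) j) then false else true).
  assert (Hch : length ch = (2 * length (survivors P n))%nat).
  { unfold ch; clear; induction (survivors P n) as [| i l IH]; [reflexivity |].
    cbn [flat_map app length]; lia. }
  assert (Hrem : (length (filter (fun j => negb (keep j)) ch) <= length C)%nat).
  { apply NoDup_incl_length.
    - apply NoDup_filter, NoDup_children, survivors_NoDup.
    - intros j Hj; apply filter_In in Hj as [Hj Hk].
      unfold keep in Hk; destruct excluded_middle_informative; [| discriminate].
      apply HC; [now apply in_children | assumption]. }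
  pose proof (filter_length keep ch) as Hf.
  change (survivors P (S n)) with (filter keep ch).
  rewrite <- plus_INR; change 2 with (INR 2); rewrite <- mult_INR.
  apply le_INR; lia.
Qed.

(** Let W_n be the number of survivors. A loss of at most 2 W_n / (n + 1) at level n + 1 gives (n +
    1) W_(n+1) >= 2 n W_n, so n W_n / 2^n never decreases. The growth up to level n may be used to
    estimate this loss, because deletions are counted below survivors of earlier levels. *)
Lemma survivors_growth (P : nat -> Z -> Prop) :
  (forall j, ~ P 1%nat j) ->
  (forall n, (1 <= n)%nat ->
     (forall m, (1 <= m <= n)%nat ->
        2 ^ (n - m) * INR m * INR (length (survivors P m))
        <= INR n * INR (length (survivors P n))) ->
     exists C, (forall j, In (j / 2)%Z (survivors P n) -> P (S n) j -> In j C) /\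
       INR (S n) * INR (length C) <= 2 * INR (length (survivors P n))) ->
  forall n m, (1 <= m <= n)%nat ->
    2 ^ (n - m) * INR m * INR (length (survivors P m))
    <= INR n * INR (length (survivors P n)).
Proof.
  intros H1 Hstep; induction n as [| n IH]; intros m Hm; [lia |].
  destruct (Nat.eq_dec m (S n)) as [-> | Hne].
  { rewrite Nat.sub_diag; simpl (2 ^ 0); lra. }
  destruct (Hstep n ltac:(lia) IH) as [C [HC HCl]].
  apply survivors_length_succ in HC.
  specialize (IH m ltac:(lia)).
  replace (S n - m)%nat with (S (n - m)) by lia.
  cbn [pow]; pose proof (pos_INR n).
  rewrite S_INR in *; nra.
Qed.

Lemma survivors_length_ge (P : nat -> Z -> Prop) (n : nat) :
  (forall j, ~ P 1%nat j) -> (1 <= n)%nat ->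
  2 ^ (n - 1) * INR 1 * INR (length (survivors P 1)) <= INR n * INR (length (survivors P n)) ->
  2 ^ n <= INR n * INR (length (survivors P n)).
Proof.
  intros H1 Hn Hg.
  assert (Hl : 2 * INR 1 <= INR (length (survivors P 1)) + INR 0).
  { apply (survivors_length_succ P 0 []); intros j _ Hj; now apply (H1 j). }
  simpl (INR 0) in Hl.
  replace n with (S (n - 1)) at 1 by lia.
  cbn [pow]; change (INR 1) with 1 in *.
  pose proof (pow2_pos (n - 1)); nra.
Qed.

(* Koenig's lemma gives an infinite branch in the tree of survivors. *)
Lemma survivors_limit (P : nat -> Z -> Prop) :
  (forall n, survivors P n <> []) ->
  exists beta : R, forall n, exists j, In j (survivors P n) /\
    IZR j <= 2 ^ n * beta <= IZR j + 1.
Proof.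
  intros Hne.
  (* A survivor may still have no descendants at some depth, so the branch is built from intervals
     with surviving descendants at every depth. *)
  set (immortal := fun n j => forall k, exists i,
    In i (survivors P (n + k)) /\ (i / 2 ^ Z.of_nat k)%Z = j).
  assert (Hstep : forall n j, immortal n j ->
    exists b, (b = 2 * j \/ b = 2 * j + 1)%Z /\ immortal (S n) b).
  { intros n j Hj; apply NNPP; intros Hno.
    assert (Hdie : forall b, (b = 2 * j \/ b = 2 * j + 1)%Z -> exists k,
      forall i, In i (survivors P (S n + k)) -> (i / 2 ^ Z.of_nat k)%Z <> b).
    { intros b Hb; apply NNPP; intros Hk; apply Hno; exists b; split; [exact Hb |].
      intros k; apply NNPP; intros Hi; apply Hk; exists k.
      intros i Hi1 Hi2; apply Hi; now exists i. }
    destruct (Hdie (2 * j)%Z (or_introl eq_refl)) as [k1 Hk1].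
    destruct (Hdie (2 * j + 1)%Z (or_intror eq_refl)) as [k2 Hk2].
    (* Suppose the children die out by depths [k1] and [k2]. A descendant [i] of [j], taken
       [k1 + k2] levels below the children, lies under one of them, and its ancestor at depth [k1]
       or [k2] contradicts the extinction of that child. *)
    destruct (Hj (S (k1 + k2))) as [i [Hi Hij]].
    assert (Hanc : forall k, (k <= k1 + k2)%nat -> exists i',
      In i' (survivors P (S n + k)) /\
      (i' / 2 ^ Z.of_nat k = i / 2 ^ Z.of_nat (k1 + k2))%Z).
    { intros k Hk; exists (i / 2 ^ Z.of_nat (k1 + k2 - k))%Z; split.
      - apply survivors_ancestor.
        now replace (S n + k + (k1 + k2 - k))%nat with (n + S (k1 + k2))%nat by lia.
      - rewrite Z.div_div by lia.
        rewrite <- Z.pow_add_r by lia; f_equal; f_equal; lia. }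
    set (b := (i / 2 ^ Z.of_nat (k1 + k2))%Z) in *.
    assert (Hb : (b = 2 * j \/ b = 2 * j + 1)%Z).
    { rewrite Nat2Z.inj_succ, Z.pow_succ_r in Hij by lia.
      rewrite Z.mul_comm, <- Z.div_div in Hij by lia; fold b in Hij.
      pose proof (Z.div_mod b 2 ltac:(lia)); pose proof (Z.mod_pos_bound b 2 ltac:(lia)); lia. }
    destruct Hb as [Hb | Hb].
    - destruct (Hanc k1 ltac:(lia)) as [i' [Hi1 Hi2]]; apply (Hk1 i' Hi1); congruence.
    - destruct (Hanc k2 ltac:(lia)) as [i' [Hi1 Hi2]]; apply (Hk2 i' Hi1); congruence. }
  assert (H0 : immortal O 0%Z).
  { intros k; destruct (survivors P k) as [| i l] eqn:El; [now destruct (Hne k) |].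
    exists i; rewrite Nat.add_0_l, El; split; [now left |].
    assert (Hi : In i (survivors P (0 + k))) by (rewrite Nat.add_0_l, El; now left).
    apply survivors_ancestor in Hi; destruct Hi as [Hi | []]; congruence. }
  set (branch := fix branch n := match n with
    | O => 0%Z
    | S k => epsilon (inhabits 0%Z)
        (fun b => (b = 2 * branch k \/ b = 2 * branch k + 1)%Z /\ immortal (S k) b)
    end).
  assert (Hbr : forall n, immortal n (branch n)).
  { induction n as [| n IH]; [exact H0 |].
    exact (proj2 (epsilon_spec (inhabits 0%Z) _ (Hstep n _ IH))). }
  assert (Hch : forall n, 2 * IZR (branch n) <= IZR (branch (S n)) <= 2 * IZR (branch n) + 1).
  { intros n.
    destruct (epsilon_spec (inhabits 0%Z) _ (Hstep n _ (Hbr n))) as [Hb _].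
    change (epsilon _ _) with (branch (S n)) in Hb.
    rewrite <- mult_IZR, <- plus_IZR; split; apply IZR_le; lia. }
  set (x := fun n => IZR (branch n) / 2 ^ n).
  set (y := fun n => (IZR (branch n) + 1) / 2 ^ n).
  assert (Hxy : forall n k, x n <= x (n + k)%nat /\ y (n + k)%nat <= y n).
  { intros n; induction k as [| k [IH1 IH2]]; [rewrite Nat.add_0_r; lra |].
    rewrite Nat.add_succ_r; destruct (Hch (n + k)%nat) as [C1 C2].
    assert (Hp := pow2_pos (n + k)).
    split; [eapply Rle_trans; [exact IH1 |] | eapply Rle_trans; [| exact IH2]];
      unfold x, y; cbn [pow];
      apply (Rmult_le_reg_r (2 * 2 ^ (n + k))); try lra; field_simplify; lra. }
  assert (Hlt : forall n, x n <= y n).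
  { intros n; unfold x, y; apply Rmult_le_compat_r; [| lra].
    apply Rlt_le, Rinv_0_lt_compat, pow2_pos. }
  assert (Hle : forall k n, x k <= y n).
  { intros k n; destruct (Nat.le_ge_cases k n) as [H | H].
    - replace n with (k + (n - k))%nat by lia.
      eapply Rle_trans; [apply (proj1 (Hxy k (n - k)%nat)) | apply Hlt].
    - replace k with (n + (k - n))%nat by lia.
      eapply Rle_trans; [apply Hlt | apply (proj2 (Hxy n (k - n)%nat))]. }
  (* The supremum of the left endpoints lies in all the nested closed intervals. *)
  destruct (completeness (fun z => exists n, z = x n)) as [beta [Hub Hlub]].
  - exists (y O); intros z [n ->]; apply Hle.
  - now exists (x O), O.
  - exists beta; intros n; exists (branch n); split.
    { destruct (Hbr n O) as [i [Hi Hi']]; rewrite Nat.add_0_r in Hi.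
      simpl in Hi'; rewrite Z.div_1_r in Hi'; congruence. }
    assert (B1 : x n <= beta) by (apply Hub; now exists n).
    assert (B2 : beta <= y n) by (apply Hlub; intros z [k ->]; apply Hle).
    assert (Hp := pow2_pos n); unfold x, y in B1, B2.
    apply (Rmult_le_compat_l (2 ^ n)) in B1; [| lra].
    apply (Rmult_le_compat_l (2 ^ n)) in B2; [| lra].
    split.
    + now replace (2 ^ n * (IZR (branch n) / 2 ^ n)) with (IZR (branch n)) in B1 by (field; lra).
    + now replace (2 ^ n * ((IZR (branch n) + 1) / 2 ^ n)) with (IZR (branch n) + 1)
        in B2 by (field; lra).
Qed.

(** * Dyadic intervals meeting small sets and neighbourhoods of fractions *)

Definition meets_dyadic (U : R -> Prop) (n : nat) (j : Z) : Prop :=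
  exists x, U x /\ IZR j <= 2 ^ n * x <= IZR j + 1.

(** After scaling by [2 ^ n] the ball has radius 1, so [j] lies in a closed interval of length 3,
    which contains at most four integers. *)
Lemma meets_dyadic_ball (n : nat) (c : R) :
  exists C, (forall j, meets_dyadic (fun x => Rabs (x - c) <= / 2 ^ n) n j -> In j C) /\
    INR (length C) <= 4.
Proof.
  set (f := up (2 ^ n * c)).
  exists [f - 3; f - 2; f - 1; f]%Z; split; [| simpl; lra].
  intros j [x [Hx [H1 H2]]].
  assert (Hp := pow2_pos n).
  destruct (archimed (2 ^ n * c)) as [A1 A2]; fold f in A1, A2.
  assert (Hs : -1 <= 2 ^ n * x - 2 ^ n * c <= 1).
  { pose proof (Rle_abs (x - c)); pose proof (Rle_abs (- (x - c))) as Hn.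
    rewrite Rabs_Ropp in Hn.
    assert (Hi : 2 ^ n * / 2 ^ n = 1) by (apply Rinv_r; lra).
    split; nra. }
  assert (L1 : (f - 3 <= j)%Z) by (apply le_IZR; rewrite minus_IZR; lra).
  assert (L2 : (j < f + 1)%Z) by (apply lt_IZR; rewrite plus_IZR; lra).
  simpl; lia.
Qed.

Lemma meets_dyadic_small (U : R -> Prop) (n : nat) :
  (forall x y, U x -> U y -> Rabs (x - y) <= / 2 ^ n) ->
  exists C, (forall j, meets_dyadic U n j -> In j C) /\ INR (length C) <= 4.
Proof.
  intros HU; destruct (classic (exists c, U c)) as [[c Hc] | Hno].
  - destruct (meets_dyadic_ball n c) as [C [HC Hl]].
    exists C; split; [| exact Hl].
    intros j [x [Hx Hj]]; apply HC; exists x; split; [now apply HU | exact Hj].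
  - exists []; split; [| simpl; lra].
    intros j [x [Hx _]]; destruct Hno; now exists x.
Qed.

Definition near_fraction (n q : nat) (x : R) : Prop :=
  exists p : Z, Rabs (x - IZR p / INR q) <= / 2 ^ n.

(** Over the level-[m] interval [k] the product [q x] varies by at most 2, and [q / 2 ^ n <= 1]
    because [q < 2 ^ (m + 1) <= 2 ^ n]. Hence at most five numerators [p] occur, each with at most
    four intervals. *)
Lemma meets_near_fraction (n m q : nat) (k : Z) :
  (m < n)%nat -> (2 ^ m <= q < 2 ^ S m)%nat ->
  exists C, (forall j, (j / 2 ^ Z.of_nat (n - m))%Z = k ->
      meets_dyadic (near_fraction n q) n j -> In j C) /\
    INR (length C) <= 20.
Proof.
  intros Hmn [Hq1 Hq2].
  apply le_INR in Hq1; apply lt_INR in Hq2; rewrite pow_INR in Hq1, Hq2.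
  cbn [pow] in Hq2; change (INR 2) with 2 in Hq1, Hq2.
  assert (Hm := pow2_pos m); assert (Hn := pow2_pos n).
  set (f := up (INR q * (IZR k / 2 ^ m))).
  destruct (finite_union_bound
    (fun p j => meets_dyadic (fun x => Rabs (x - IZR p / INR q) <= / 2 ^ n) n j)
    [f - 2; f - 1; f; f + 1; f + 2]%Z 4) as [C [HC Hl]].
  { intros p _; apply meets_dyadic_ball. }
  exists C; split; [| simpl in Hl; lra].
  intros j Hjk [x [[p Hp] [Hx1 Hx2]]].
  apply (HC p j); [| now exists x].
  assert (Hn2 : 2 ^ n = 2 ^ m * 2 ^ (n - m)) by (rewrite <- pow_add; f_equal; lia).
  assert (Hd := pow2_pos (n - m)).
  assert (Hkj : IZR k * 2 ^ (n - m) <= IZR j /\ IZR j + 1 <= (IZR k + 1) * 2 ^ (n - m)).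
  { rewrite <- IZR_pow2, <- !plus_IZR, <- !mult_IZR.
    pose proof (Z.pow_pos_nonneg 2 (Z.of_nat (n - m)) ltac:(lia) ltac:(lia)).
    pose proof (Z.div_mod j (2 ^ Z.of_nat (n - m)) ltac:(lia)).
    pose proof (Z.mod_pos_bound j (2 ^ Z.of_nat (n - m)) ltac:(lia)).
    split; apply IZR_le; subst k; nia. }
  assert (Hxk : IZR k <= 2 ^ m * x <= IZR k + 1).
  { rewrite Hn2 in Hx1, Hx2; split; apply (Rmult_le_reg_r (2 ^ (n - m))); nra. }
  assert (Hqx : -1 <= IZR p - INR q * x <= 1).
  { assert (Hqn : INR q * / 2 ^ n <= 1).
    { apply (Rmult_le_reg_r (2 ^ n)); [lra |].
      rewrite Rmult_assoc, Rinv_l, Rmult_1_r, Rmult_1_l by lra.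
      assert (2 * 2 ^ m <= 2 ^ n).
      { change (2 * 2 ^ m) with (2 ^ S m); apply Rle_pow; [lra | lia]. }
      lra. }
    assert (Hpx : IZR p - INR q * x = - (INR q * (x - IZR p / INR q))) by (field; lra).
    pose proof (Rle_abs (x - IZR p / INR q)).
    pose proof (Rle_abs (- (x - IZR p / INR q))) as Hneg; rewrite Rabs_Ropp in Hneg.
    rewrite Hpx; split; nra. }
  assert (Hy : INR q * (IZR k / 2 ^ m) <= INR q * x <= INR q * (IZR k / 2 ^ m) + 2).
  { assert (Ht : IZR k = 2 ^ m * (IZR k / 2 ^ m)) by (field; lra).
    set (t := IZR k / 2 ^ m) in *; rewrite Ht in Hxk.
    assert (T1 : t <= x) by nra.
    assert (T2 : 2 ^ m * (x - t) <= 1) by lra.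
    split; nra. }
  destruct (archimed (INR q * (IZR k / 2 ^ m))) as [A1 A2]; fold f in A1, A2.
  assert (L1 : (f - 2 <= p)%Z) by (apply le_IZR; rewrite minus_IZR; lra).
  assert (L2 : (p < f + 3)%Z) by (apply lt_IZR; rewrite plus_IZR; lra).
  simpl; lia.
Qed.

(** * Multiples of alpha close to integers *)

(* The points [q alpha] mod 1 with [q] in a dyadic block are [c / 2 ^ m]-separated. *)
Lemma count_small_dnint (alpha c D : R) (m : nat) :
  0 < c -> 0 <= D ->
  (forall q : nat, (1 <= q)%nat -> c <= INR q * dnint (INR q * alpha)) ->
  exists l : list nat,
    (forall q, (2 ^ m <= q < 2 ^ S m)%nat -> dnint (INR q * alpha) <= D -> In q l) /\
    (forall q, In q l -> (2 ^ m <= q < 2 ^ S m)%nat) /\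
    INR (length l) <= 6 * D * 2 ^ m / c.
Proof.
  intros Hc HD Hbad.
  set (l := filter (fun q => if Rle_dec (dnint (INR q * alpha)) D then true else false)
              (seq (2 ^ m) (2 ^ m))).
  assert (Hl : forall q, In q l <-> (2 ^ m <= q < 2 ^ S m)%nat /\ dnint (INR q * alpha) <= D).
  { intros q; unfold l; rewrite filter_In, in_seq, Nat.pow_succ_r'.
    destruct Rle_dec; intuition (try discriminate; try lia; try contradiction). }
  exists l; split; [| split]; [intros q H1 H2; now apply Hl | intros q Hq; now apply Hl |].
  assert (Hm := pow2_pos m).
  (* The signed distance from [q alpha] to a chosen nearest integer. *)
  set (t := fun q => INR q * alpha - IZR (epsilon (inhabits 0%Z)
    (fun p => Rabs (INR q * alpha - IZR p) = dnint (INR q * alpha)))).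
  assert (Ht : forall q, Rabs (t q) = dnint (INR q * alpha)).
  { intros q; apply (epsilon_spec (inhabits 0%Z)
      (fun p => Rabs (INR q * alpha - IZR p) = dnint (INR q * alpha))).
    apply dnint_attained. }
  assert (Hlt : forall a b, In a l -> In b l -> (a < b)%nat -> c / 2 ^ m <= Rabs (t b - t a)).
  { intros a b Ha Hb Hab; apply Hl in Ha as [[Ha1 Ha2] _]; apply Hl in Hb as [[Hb1 Hb2] _].
    specialize (Hbad (b - a)%nat ltac:(lia)).
    assert (Hle : INR (b - a) <= 2 ^ m).
    { replace (2 ^ m) with (INR (2 ^ m)) by (rewrite pow_INR; reflexivity).
      apply le_INR; rewrite Nat.pow_succ_r' in Hb2; lia. }
    assert (Hd : dnint (INR (b - a) * alpha) <= Rabs (t b - t a)).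
    { unfold t.
      match goal with |- _ <= Rabs (_ - IZR ?u - (_ - IZR ?v)) =>
        replace (INR b * alpha - IZR u - (INR a * alpha - IZR v))
          with (INR (b - a) * alpha - IZR (u - v))
          by (rewrite minus_IZR, minus_INR by lia; ring) end.
      apply dnint_le_dist. }
    apply (Rmult_le_reg_r (2 ^ m)); [lra |].
    unfold Rdiv; rewrite Rmult_assoc, Rinv_l, Rmult_1_r by lra.
    pose proof (Rabs_pos (t b - t a)); pose proof (pos_INR (b - a)); nra. }
  assert (Hsep : INR (length l) <= 2 * D / (c / 2 ^ m) + 2).
  { apply (separated_length t).
    - apply Rdiv_lt_0_compat; lra.
    - exact HD.
    - apply NoDup_filter, seq_NoDup.
    - intros q Hq; rewrite Ht; now apply Hl.
    - intros a b Ha Hb Hne.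
      destruct (Nat.lt_total a b) as [H | [H | H]]; [| contradiction | now apply Hlt].
      rewrite Rabs_minus_sym; now apply Hlt. }
  (* The additive 2 is absorbed into the main term: a single member [q] forces
     [c <= q D <= 2 ^ (m + 1) D], that is, [1 <= 2 * D * 2 ^ m / c]. *)
  destruct l as [| q l'] eqn:El.
  { simpl; apply Rle_mult_inv_pos; [nra | lra]. }
  assert (Hq : In q (q :: l')) by now left.
  apply Hl in Hq as [[Hq1 Hq2] Hq3].
  assert (H1 : (1 <= q)%nat) by (pose proof (Nat.pow_nonzero 2 m); lia).
  specialize (Hbad q H1).
  apply lt_INR in Hq2; rewrite pow_INR in Hq2; cbn [pow] in Hq2; change (INR 2) with 2 in Hq2.
  assert (Hone : 1 <= 2 * D * 2 ^ m / c).
  { apply (Rmult_le_reg_r c); [lra |].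
    unfold Rdiv; rewrite Rmult_assoc, Rinv_l, Rmult_1_r by lra.
    pose proof (pos_INR q); pose proof (dnint_ge0 (INR q * alpha)); nra. }
  replace (2 * D / (c / 2 ^ m)) with (2 * D * 2 ^ m / c) in Hsep by (field; lra).
  replace (6 * D * 2 ^ m / c) with (3 * (2 * D * 2 ^ m / c)) by (field; lra).
  lra.
Qed.

(** * The deletion rule and a point that escapes it *)

(** Of the requirement that 2^(-n) be comparable to eps / (q^2 m^2 ||q alpha||), only an upper bound
    on ||q alpha|| is kept, with 4^m replacing q^2; the qualifying [q] can then be counted by
    separation. The relation [at_level i n] schedules the set [U i] for deletion at level [n]. *)
Definition removed (alpha eps : R) (n0 : nat) (U : nat -> R -> Prop)
    (at_level : nat -> nat -> Prop) (n : nat) (j : Z) : Prop :=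
  (n0 < n)%nat /\
  ((exists m q, (n0 <= m < n)%nat /\ (n <= 3 * m)%nat /\ (2 ^ m <= q < 2 ^ S m)%nat /\
      dnint (INR q * alpha) <= eps * 2 ^ S n / (4 ^ m * INR m ^ 2) /\
      meets_dyadic (near_fraction n q) n j) \/
   (exists i, at_level i n /\ meets_dyadic (U i) n j)).

(* For each [m] there are [O(eps 2 ^ (n - m) / m ^ 2)] relevant [q], and each removes [O(1)]
   intervals below every survivor of level [m]; the constant [12960 = 9 * 1440] makes the total
   at most [W_n / (n + 1) ^ 2]. *)
Lemma removed_block_bound (alpha c : R) (P : nat -> Z -> Prop) (n m : nat) :
  0 < c -> (forall q : nat, (1 <= q)%nat -> c <= INR q * dnint (INR q * alpha)) ->
  (1 <= m <= n)%nat -> (S n <= 3 * m)%nat ->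
  2 ^ (n - m) * INR m * INR (length (survivors P m)) <= INR n * INR (length (survivors P n)) ->
  exists C,
    (forall j, (exists q, In (j / 2)%Z (survivors P n) /\ (2 ^ m <= q < 2 ^ S m)%nat /\
        dnint (INR q * alpha) <= c / 12960 * 2 ^ S (S n) / (4 ^ m * INR m ^ 2) /\
        meets_dyadic (near_fraction (S n) q) (S n) j) -> In j C) /\
    INR (length C) <= INR (length (survivors P n)) / INR (S n) ^ 2.
Proof.
  intros Hc Hbad Hm Hn Hg.
  set (D := c / 12960 * 2 ^ S (S n) / (4 ^ m * INR m ^ 2)).
  assert (Hm1 : 1 <= INR m) by (change 1 with (INR 1); apply le_INR; lia).
  assert (H4 : 4 ^ m = 2 ^ m * 2 ^ m).
  { rewrite <- Rpow_mult_distr; f_equal; lra. }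
  assert (Hp := pow2_pos m); assert (Hpn := pow2_pos n); assert (Hpd := pow2_pos (n - m)).
  assert (Hsplit : 2 ^ n = 2 ^ m * 2 ^ (n - m)) by (rewrite <- pow_add; f_equal; lia).
  assert (HD : 0 <= D).
  { unfold D; apply Rle_mult_inv_pos.
    - apply Rmult_le_pos; [lra | apply Rlt_le, pow2_pos].
    - apply Rmult_lt_0_compat; apply pow_lt; lra. }
  destruct (count_small_dnint alpha c D m Hc HD Hbad) as [l [Hl1 [Hl2 Hl3]]].
  destruct (finite_union_bound
    (fun q j => In (j / 2)%Z (survivors P n) /\ meets_dyadic (near_fraction (S n) q) (S n) j)
    l (INR (length (survivors P m)) * 20)) as [C [HC HCl]].
  { intros q Hq.
    (* The intervals are sorted by their level-[m] ancestor [k], itself a survivor. *)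
    destruct (finite_union_bound
      (fun k j => (j / 2 ^ Z.of_nat (S n - m))%Z = k /\
         meets_dyadic (near_fraction (S n) q) (S n) j)
      (survivors P m) 20) as [C [HC HCl]].
    { intros k _; destruct (meets_near_fraction (S n) m q k) as [C [HC HCl]];
        [lia | now apply Hl2 |].
      exists C; split; [intros j [H1 H2]; now apply HC | exact HCl]. }
    exists C; split; [| exact HCl].
    intros j [Hj Hmeet]; apply (HC (j / 2 ^ Z.of_nat (S n - m))%Z); [| now split].
    replace (S n - m)%nat with (S (n - m)) by lia; rewrite Zdiv2_pow_succ.
    apply survivors_ancestor.
    now replace (m + (n - m))%nat with n by lia. }
  exists C; split.
  { intros j [q [H1 [H2 [H3 H4']]]]; apply (HC q); [now apply Hl1 | now split]. }
  set (wm := INR (length (survivors P m))) in *; set (wn := INR (length (survivors P n))) in *.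
  assert (Hwm : 0 <= wm) by apply pos_INR.
  assert (Hwn : 0 <= wn) by apply pos_INR.
  assert (Hn3 : INR (S n) <= 3 * INR m).
  { replace 3 with (INR 3) by (simpl; lra); rewrite <- mult_INR; apply le_INR; lia. }
  (* Since [n + 1 <= 3 m], the ratio [n / m] in the growth bound costs at most a factor 3. *)
  assert (Hgm : 2 ^ (n - m) * wm <= 3 * wn).
  { apply (Rmult_le_reg_l (INR m)); [lra |]; rewrite S_INR in Hn3; nra. }
  assert (HSn : 0 < INR (S n)) by (apply lt_0_INR; lia).
  eapply Rle_trans; [exact HCl |].
  assert (Hstep : INR (length l) * (wm * 20) <= 6 * D * 2 ^ m / c * (wm * 20))
    by (apply Rmult_le_compat_r; lra).
  eapply Rle_trans; [exact Hstep |].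
  (* The constants combine to 6 * 20 * 4 / 12960 = 1 / 27, where the 4 comes from [2 ^ S (S n)]. *)
  replace (6 * D * 2 ^ m / c * (wm * 20)) with (2 ^ (n - m) * wm / (27 * INR m ^ 2)).
  2:{ unfold D; rewrite H4; cbn [pow]; rewrite Hsplit; field; lra. }
  apply Rle_trans with (wn / (9 * INR m ^ 2)).
  - apply (Rmult_le_reg_r (27 * INR m ^ 2)); [nra |].
    field_simplify; try lra.
  - apply Rmult_le_compat_l; [lra |].
    apply Rinv_le_contravar; [apply pow_lt; lra | nra].
Qed.

(** The loss 2 W_n / (n + 1) allowed at level n + 1 is split in two equal halves. The fractions use
    at most n + 1 blocks [m], each costing W_n / (n + 1)^2. The scheduled sets cost four intervals
    each, in total at most 2^n / (n + 1)^2, and 2^n <= n W_n. *)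
Lemma avoiding_point (alpha c : R) (n0 : nat) (U : nat -> R -> Prop)
    (at_level : nat -> nat -> Prop) :
  0 < c -> (forall q : nat, (1 <= q)%nat -> c <= INR q * dnint (INR q * alpha)) ->
  (1 <= n0)%nat ->
  (forall i n x y, at_level i n -> U i x -> U i y -> Rabs (x - y) <= / 2 ^ n) ->
  (forall n, (n0 < n)%nat -> exists l, (forall i, at_level i n -> In i l) /\
     8 * INR n ^ 2 * INR (length l) <= 2 ^ n) ->
  exists beta : R,
    (forall m q n, (n0 <= m < n)%nat -> (n <= 3 * m)%nat -> (2 ^ m <= q < 2 ^ S m)%nat ->
       dnint (INR q * alpha) <= c / 12960 * 2 ^ S n / (4 ^ m * INR m ^ 2) ->
       ~ near_fraction n q beta) /\
    (forall i n, (n0 < n)%nat -> at_level i n -> ~ U i beta).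
Proof.
  intros Hc Hbad Hn0 HU Hcount.
  set (P := removed alpha (c / 12960) n0 U at_level).
  assert (HP1 : forall j, ~ P 1%nat j) by (intros j [H _]; lia).
  assert (Hgrow : forall n m, (1 <= m <= n)%nat ->
    2 ^ (n - m) * INR m * INR (length (survivors P m))
    <= INR n * INR (length (survivors P n))).
  { apply survivors_growth; [exact HP1 |].
    intros n Hn IH; set (w := INR (length (survivors P n))) in *.
    assert (Hw : 0 <= w) by apply pos_INR.
    destruct (Nat.lt_ge_cases n n0) as [Hlt | Hge].
    { exists []; split; [intros j _ [H _]; lia | simpl (length []); change (INR 0) with 0; lra]. }
    assert (HSn : 0 < INR (S n)) by (apply lt_0_INR; lia).
    destruct (finite_union_bound
      (fun m j => (n0 <= m)%nat /\ (S n <= 3 * m)%nat /\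
        exists q, In (j / 2)%Z (survivors P n) /\ (2 ^ m <= q < 2 ^ S m)%nat /\
        dnint (INR q * alpha) <= c / 12960 * 2 ^ S (S n) / (4 ^ m * INR m ^ 2) /\
        meets_dyadic (near_fraction (S n) q) (S n) j)
      (seq 0 (S n)) (w / INR (S n) ^ 2)) as [C1 [HC1 Hl1]].
    { intros m Hm; apply in_seq in Hm.
      destruct (classic ((n0 <= m)%nat /\ (S n <= 3 * m)%nat)) as [[A1 A2] | Hno].
      - destruct (removed_block_bound alpha c P n m Hc Hbad) as [C [HC HCl]];
          [lia | lia | apply IH; lia |].
        exists C; split; [intros j [_ [_ Hj]]; now apply HC | exact HCl].
      - exists []; split; [intros j [B1 [B2 _]]; tauto |].
        simpl (length []); change (INR 0) with 0.
        apply Rle_mult_inv_pos; [exact Hw | apply pow_lt; lra]. }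
    rewrite length_seq in Hl1.
    destruct (Hcount (S n) ltac:(lia)) as [li [Hli Hlen]].
    destruct (finite_union_bound
      (fun i j => at_level i (S n) /\ meets_dyadic (U i) (S n) j) li 4) as [C2 [HC2 Hl2]].
    { intros i _; destruct (classic (at_level i (S n))) as [Hi | Hi].
      - destruct (meets_dyadic_small (U i) (S n)) as [C [HC HCl]].
        { intros x y; now apply HU. }
        exists C; split; [intros j [_ Hj]; now apply HC | exact HCl].
      - exists []; split; [tauto | simpl; lra]. }
    exists (C1 ++ C2); split.
    - intros j Hj [_ [[m [q [Q1 [Q2 [Q3 [Q4 Q5]]]]]] | [i [I1 I2]]]]; apply in_or_app.
      + left; apply (HC1 m); [apply in_seq; lia |].
        split; [lia | split; [lia | now exists q]].
      + right; apply (HC2 i); auto.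
    - rewrite length_app, plus_INR.
      assert (E1 : INR (S n) * INR (length C1) <= w).
      { apply Rle_trans with (INR (S n) * (INR (S n) * (w / INR (S n) ^ 2))).
        - apply Rmult_le_compat_l; lra.
        - right; field; lra. }
      assert (E2 : INR (S n) * INR (length C2) <= w).
      { assert (Hnw : 2 ^ n <= INR n * w)
          by (apply survivors_length_ge; [exact HP1 | exact Hn | apply IH; lia]).
        cbn [pow] in Hlen; rewrite Rmult_1_r in Hlen.
        apply (Rmult_le_reg_l (INR (S n))); [lra |].
        assert (Hsq : INR (S n) * INR (S n) * INR (length C2)
                      <= INR (S n) * INR (S n) * (INR (length li) * 4))
          by (apply Rmult_le_compat_l; [nra | exact Hl2]).
        assert (Hnn : INR n * w <= INR (S n) * w) by (rewrite S_INR; lra).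
        lra. }
      lra. }
  destruct (survivors_limit P) as [beta Hbeta].
  { intros n Hnil; destruct n as [| n]; [discriminate |].
    assert (H := survivors_length_ge P (S n) HP1 ltac:(lia) (Hgrow (S n) 1%nat ltac:(lia))).
    rewrite Hnil in H; simpl (length []) in H; change (INR 0) with 0 in H.
    pose proof (pow2_pos (S n)); lra. }
  assert (Hsurv : forall n, (0 < n)%nat -> exists j, ~ P n j /\
    IZR j <= 2 ^ n * beta <= IZR j + 1).
  { intros n Hn; destruct (Hbeta n) as [j [Hj Hb]]; exists j; split; [| exact Hb].
    destruct n as [| n]; [lia |]; now apply in_survivors_succ in Hj. }
  exists beta; split.
  - intros m q n H1 H2 H3 H4 H5.
    destruct (Hsurv n ltac:(lia)) as [j [Hj Hb]]; apply Hj.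
    split; [lia | left; exists m, q]; do 4 (split; [assumption |]); now exists beta.
  - intros i n H1 H2 H3.
    destruct (Hsurv n ltac:(lia)) as [j [Hj Hb]]; apply Hj.
    split; [lia | right; exists i]; split; [assumption | now exists beta].
Qed.

(** * From avoidance of fractions to the positive lower limit *)

(** A cube dominates: exp x = (exp (x / 3))^3 >= (x / 3)^3 for x >= 0. *)
Lemma square_le_exp (M kappa : R) :
  0 < kappa -> exists N : nat, forall n, (N <= n)%nat -> M * INR n ^ 2 <= exp (kappa * INR n).
Proof.
  intros Hk.
  destruct (INR_archimed (kappa ^ 3) (27 * M)) as [N HN]; [apply pow_lt, Hk |].
  exists N; intros n Hn; apply le_INR in Hn.
  assert (Hx : 0 <= kappa * INR n) by (pose proof (pos_INR n); nra).
  set (x := kappa * INR n) in *.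
  assert (He : x / 3 <= exp (x / 3)) by (pose proof (exp_ineq1_le (x / 3)); lra).
  replace (exp x) with (exp (x / 3) ^ 3)
    by (cbn [pow]; rewrite Rmult_1_r, <- !exp_plus; f_equal; field).
  apply Rle_trans with ((x / 3) ^ 3).
  - unfold x; pose proof (pow_lt kappa 3 Hk).
    assert (H27 : 27 * M <= INR n * kappa ^ 3) by nra.
    pose proof (pow2_ge_0 (INR n)).
    replace ((kappa * INR n / 3) ^ 3) with (INR n * kappa ^ 3 * INR n ^ 2 / 27) by field.
    nra.
  - apply pow_incr; lra.
Qed.

Lemma pow2_exp (n : nat) : 2 ^ n = exp (INR n * ln 2).
Proof. rewrite <- Rpower_pow by lra; reflexivity. Qed.

Lemma dyadic_block (q : nat) : (1 <= q)%nat -> exists m, (2 ^ m <= q < 2 ^ S m)%nat.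
Proof. intros H; exists (Nat.log2 q); apply Nat.log2_spec; lia. Qed.

(** A discrete intermediate value principle, used to select a scale. *)
Lemma last_step (Q : nat -> Prop) (a b : nat) :
  (a <= b)%nat -> Q a -> ~ Q (S b) -> exists n, (a <= n <= b)%nat /\ Q n /\ ~ Q (S n).
Proof.
  intros Hab Ha Hb.
  induction Hab as [| b Hab IH]; [exists a; auto with arith |].
  destruct (classic (Q (S b))) as [H | H]; [exists (S b); auto |].
  destruct (IH H) as [n [Hn HQ]]; exists n; split; [lia | exact HQ].
Qed.

(** Choose [n] with eps 2^n <= q^2 m^2 ||q alpha|| < eps 2^(n+1). Avoiding every p/q at scale 2^(-n)
    means ||q beta|| >= q / 2^n, and multiplying the two lower bounds gives q m^2 ||q alpha|| ||q
    beta|| >= eps. *)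
Lemma liminf_pos_of_avoiding (alpha c beta : R) (n0 : nat) :
  0 < c -> (forall q : nat, (1 <= q)%nat -> c <= INR q * dnint (INR q * alpha)) ->
  (1 <= n0)%nat ->
  (forall m, (n0 <= m)%nat -> 4 * INR m ^ 2 <= c / 12960 * 2 ^ m) ->
  (forall m q n, (n0 <= m < n)%nat -> (n <= 3 * m)%nat -> (2 ^ m <= q < 2 ^ S m)%nat ->
     dnint (INR q * alpha) <= c / 12960 * 2 ^ S n / (4 ^ m * INR m ^ 2) ->
     ~ near_fraction n q beta) ->
  liminf_pos (fun q : nat =>
    INR q * (ln (INR q))^2 * dnint (INR q * alpha) * dnint (INR q * beta)).
Proof.
  intros Hc Hbad Hn0 Hbig Hav.
  set (eps := c / 12960) in *.
  assert (Heps : 0 < eps) by (unfold eps; lra).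
  exists (eps / 4); split; [lra |].
  exists (2 ^ n0)%nat; intros q Hq.
  assert (Hq1 : (1 <= q)%nat) by (pose proof (Nat.pow_nonzero 2 n0); lia).
  destruct (dyadic_block q Hq1) as [m Hm].
  assert (Hnm : (n0 <= m)%nat).
  { apply Nat.lt_succ_r, (Nat.pow_lt_mono_r_iff 2); lia. }
  specialize (Hbad q Hq1); specialize (Hbig m Hnm).
  assert (Hm1 : 1 <= INR m) by (change 1 with (INR 1); apply le_INR; lia).
  assert (Hr : 2 ^ m <= INR q < 2 * 2 ^ m).
  { destruct Hm as [A1 A2]; apply le_INR in A1; apply lt_INR in A2.
    rewrite pow_INR in A1, A2; split; [exact A1 | exact A2]. }
  set (d := dnint (INR q * alpha)) in *.
  assert (Hd0 : 0 <= d) by apply dnint_ge0.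
  assert (Hd1 : d <= 1) by apply dnint_le1.
  assert (Hp := pow2_pos m).
  set (X := INR q ^ 2 * INR m ^ 2 * d).
  (* The scale [2 ^ - n] is comparable to [eps / (q ^ 2 m ^ 2 ||q alpha||)]. *)
  destruct (last_step (fun n => eps * 2 ^ n <= X) (S m) (3 * m)) as [n [Hn [HX1 HX2]]].
  - lia.
  (* Bad approximability gives [q ^ 2 * d >= c * q >= c * 2 ^ m], so the scale lies beyond level
     [m]. *)
  - cbn [pow]; unfold X.
    assert (Hsq : 1 <= INR m ^ 2) by nra.
    assert (Hqd : INR q * c <= INR q ^ 2 * d) by nra.
    assert (2 ^ m * c <= INR q ^ 2 * d) by nra.
    apply Rle_trans with (2 ^ m * c); [unfold eps; nra |].
    replace (INR q ^ 2 * INR m ^ 2 * d) with (INR q ^ 2 * d * INR m ^ 2) by ring.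
    apply Rle_trans with (INR q ^ 2 * d * 1); [lra |].
    apply Rmult_le_compat_l; [nra | exact Hsq].
  (* Here [X <= 4 * 4 ^ m * m ^ 2 <= eps * 8 ^ m] by the largeness of [m], so the scale is at most
     [3 * m]. *)
  - apply Rlt_not_le; unfold X.
    assert (H8 : 2 ^ S (3 * m) = 2 * (2 ^ m * 2 ^ m * 2 ^ m)).
    { cbn [pow]; replace (3 * m)%nat with (m + m + m)%nat by lia; now rewrite !pow_add. }
    rewrite H8.
    assert (Hq2 : INR q ^ 2 <= 4 * (2 ^ m * 2 ^ m)) by nra.
    assert (Hqm : INR q ^ 2 * INR m ^ 2 <= 4 * (2 ^ m * 2 ^ m) * INR m ^ 2)
      by (apply Rmult_le_compat_r; [apply pow2_ge_0 | exact Hq2]).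
    assert (Hqmd : INR q ^ 2 * INR m ^ 2 * d <= INR q ^ 2 * INR m ^ 2 * 1)
      by (apply Rmult_le_compat_l; [apply Rmult_le_pos; apply pow2_ge_0 | exact Hd1]).
    assert (Hb2 : 2 ^ m * 2 ^ m * (4 * INR m ^ 2) <= 2 ^ m * 2 ^ m * (eps * 2 ^ m))
      by (apply Rmult_le_compat_l; [nra | exact Hbig]).
    assert (0 < eps * (2 ^ m * 2 ^ m * 2 ^ m)) by (repeat apply Rmult_lt_0_compat; lra).
    lra.
  - apply Rnot_le_lt in HX2.
    assert (Hnear : ~ near_fraction n q beta).
    { apply (Hav m q n); try lia.
      assert (H4 : 4 ^ m = 2 ^ m * 2 ^ m) by (rewrite <- Rpow_mult_distr; f_equal; lra).
      apply (Rmult_le_reg_r (4 ^ m * INR m ^ 2)); [rewrite H4; apply Rmult_lt_0_compat; nra |].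
      unfold Rdiv at 1; rewrite Rmult_assoc, Rinv_l, Rmult_1_r
        by (apply Rgt_not_eq; rewrite H4; apply Rmult_lt_0_compat; nra).
      apply Rle_trans with X; [| lra].
      unfold X; fold d; rewrite H4.
      assert (2 ^ m * 2 ^ m <= INR q ^ 2) by nra.
      replace (d * (2 ^ m * 2 ^ m * INR m ^ 2)) with (2 ^ m * 2 ^ m * (INR m ^ 2 * d)) by ring.
      rewrite (Rmult_assoc (INR q ^ 2)).
      apply Rmult_le_compat_r; [apply Rmult_le_pos; [apply pow2_ge_0 | exact Hd0] | lra]. }
    assert (Hpn := pow2_pos n).
    assert (Hbeta : INR q <= dnint (INR q * beta) * 2 ^ n).
    { destruct (dnint_attained (INR q * beta)) as [p Hp'].
      apply Rnot_lt_le; intros Hlt; apply Hnear; exists p.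
      replace (beta - IZR p / INR q) with ((INR q * beta - IZR p) / INR q) by (field; lra).
      unfold Rdiv; rewrite Rabs_mult, Hp', (Rabs_right (/ INR q))
        by (apply Rle_ge, Rlt_le, Rinv_0_lt_compat; lra).
      apply (Rmult_le_reg_r (INR q * 2 ^ n)); [apply Rmult_lt_0_compat; lra |].
      field_simplify; lra. }
    set (e := dnint (INR q * beta)) in *.
    assert (He0 : 0 <= e) by apply dnint_ge0.
    (* Since ln 2 > 1/2, [ln q >= m / 2]; squaring this produces the 4 in [eps / 4]. *)
    assert (Hln : INR m / 2 <= ln (INR q)).
    { apply Rle_trans with (ln (2 ^ m)).
      - rewrite pow2_exp, ln_exp; pose proof ln_lt_2; nra.
      - destruct (proj1 Hr) as [H | <-]; [apply Rlt_le, ln_increasing; lra | lra]. }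
    assert (Hln2 : INR m ^ 2 / 4 <= ln (INR q) ^ 2) by nra.
    assert (Hmain : eps <= INR q * INR m ^ 2 * d * e).
    { apply (Rmult_le_reg_r (2 ^ n)); [lra |].
      eapply Rle_trans; [exact HX1 |]; unfold X.
      replace (INR q ^ 2 * INR m ^ 2 * d) with (INR q * INR m ^ 2 * d * INR q) by ring.
      rewrite (Rmult_assoc _ e); apply Rmult_le_compat_l; [| exact Hbeta].
      repeat apply Rmult_le_pos; try lra. }
    apply Rle_trans with (INR q * (INR m ^ 2 / 4) * d * e); [lra |].
    apply Rmult_le_compat_r; [lra |]; apply Rmult_le_compat_r; [lra |].
    apply Rmult_le_compat_l; lra.
Qed.

(** * Lower bound for the dimension: exponents s < 1 *)

Lemma exp_le_compat (x y : R) : x <= y -> exp x <= exp y.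
Proof. intros [H | ->]; [apply Rlt_le, exp_increasing, H | lra]. Qed.

(** Chebyshev's inequality for a series of nonnegative terms. *)
Lemma infinite_sum_large_terms (f : nat -> R) (l t : R) :
  (forall i, 0 <= f i) -> infinite_sum f l -> 0 < t ->
  exists L, (forall i, t <= f i -> In i L) /\ t * INR (length L) <= l.
Proof.
  intros Hf Hsum Ht.
  (* Two consecutive partial sums within [t / 2] of [l] differ by less than [t], so no term after
     [N] is large. *)
  destruct (Hsum (t / 2) ltac:(lra)) as [N HN].
  set (big := fun i => if Rle_dec t (f i) then true else false).
  exists (filter big (seq 0 (S N))); split.
  - intros i Hi; apply filter_In; split.
    + apply in_seq; destruct (Nat.le_gt_cases i N) as [H | H]; [lia |].
      destruct i as [| i]; [lia |].
      assert (H1 := HN i ltac:(lia)); assert (H2 := HN (S i) ltac:(lia)).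
      unfold Rdist in H1, H2; cbn [sum_f_R0] in H2.
      apply Rabs_def2 in H1; apply Rabs_def2 in H2; lra.
    + unfold big; destruct Rle_dec; [reflexivity | contradiction].
  - assert (Hle : forall n, t * INR (length (filter big (seq 0 (S n)))) <= sum_f_R0 f n).
    { induction n as [| n IH].
      - simpl; unfold big; destruct Rle_dec; simpl; pose proof (Hf O); lra.
      - rewrite seq_S, filter_app, length_app, plus_INR, Nat.add_0_l.
        cbn [sum_f_R0 filter]; unfold big at 2; pose proof (Hf (S n)).
        destruct Rle_dec; simpl (INR (length [_])); simpl (INR (length [])); lra. }
    eapply Rle_trans; [apply Hle |].
    apply sum_incr; assumption.
Qed.

Lemma powd_ge0 (d s : R) : 0 <= powd d s.
Proof. unfold powd; destruct Rle_dec; [lra | apply Rlt_le, exp_pos]. Qed.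

Lemma dyadic_scale (n0 : nat) (d : R) :
  0 < d <= / 2 ^ S n0 -> exists n, (n0 < n)%nat /\ / 2 ^ S n < d <= / 2 ^ n.
Proof.
  intros [Hd Hd0].
  destruct (INR_archimed 1 (/ d) ltac:(lra)) as [N HN].
  assert (Hsmall : / 2 ^ S (S n0 + N) < d).
  { rewrite <- (Rinv_inv d); apply Rinv_lt_contravar.
    - apply Rmult_lt_0_compat; [apply Rinv_0_lt_compat, Hd | apply pow2_pos].
    - assert (HN' : INR (S (S n0 + N)) < 2 ^ S (S n0 + N)).
      { replace (2 ^ S (S n0 + N)) with (INR (2 ^ S (S n0 + N))) by (rewrite pow_INR; reflexivity).
        apply lt_INR, Nat.pow_gt_lin_r; lia. }
      assert (INR N <= INR (S (S n0 + N))) by (apply le_INR; lia).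
      lra. }
  destruct (last_step (fun n => d <= / 2 ^ n) (S n0) (S n0 + N)) as [n [Hn [H1 H2]]];
    [lia | exact Hd0 | lra |].
  exists n; split; [lia | lra].
Qed.

Lemma hausdorff_null_lower (alpha s : R) :
  badly_approximable alpha -> 0 < s -> s < 1 ->
  ~ hausdorff_null s (fun beta : R => liminf_pos (fun q : nat =>
      INR q * (ln (INR q))^2 * dnint (INR q * alpha) * dnint (INR q * beta))).
Proof.
  intros [c [Hc Hbad]] Hs0 Hs1 Hnull.
  assert (Hln2 : 0 < ln 2) by (rewrite <- ln_1; apply ln_increasing; lra).
  (* The gap 1 - s pays for the polynomial factor: 16 * 2^s * n^2 <= 2^((1-s) n) from [N1] on. *)
  destruct (square_le_exp (16 * exp (s * ln 2)) ((1 - s) * ln 2)) as [N1 HN1].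
  { apply Rmult_lt_0_compat; lra. }
  destruct (square_le_exp (4 / (c / 12960)) (ln 2) Hln2) as [N2 HN2].
  set (n0 := S (N1 + N2)).
  (* With this mesh every positive diameter belongs to a level above [n0]. *)
  destruct (Hnull (/ 2 ^ S n0) 1) as [U [d [Hcov [Hdiam [l [Hsum Hl]]]]]].
  { apply Rinv_0_lt_compat, pow2_pos. }
  { lra. }
  (* A set of diameter 0 has no scale and contributes nothing to the sum, so its size cannot place
     it. Level [S n0 + i] is assigned to it, which adds at most one index to each level. *)
  set (at_level := fun i n => (/ 2 ^ S n < d i <= / 2 ^ n) \/ (d i = 0 /\ n = (S n0 + i)%nat)).
  destruct (avoiding_point alpha c n0 U at_level Hc Hbad) as [beta [Hb1 Hb2]].
  - lia.
  - intros i n x y Hlev Hx Hy.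
    destruct (proj1 (Hdiam i)) as [_ [Hxy _]].
    eapply Rle_trans; [now apply Hxy |].
    destruct Hlev as [[_ H] | [-> _]]; [exact H |].
    apply Rlt_le, Rinv_0_lt_compat, pow2_pos.
  - intros n Hn.
    (* Each set of positive diameter at level [n] contributes at least [t] to a sum of at most 1, so
       there are at most 1 / t = 2^((n+1)s) of them. *)
    set (t := Rpower (/ 2 ^ S n) s).
    destruct (infinite_sum_large_terms (fun i => powd (d i) s) l t) as [L [HL Hlen]].
    { intros i; apply powd_ge0. }
    { exact Hsum. }
    { apply exp_pos. }
    (* The head is the only possible index of diameter 0 at level [n]. *)
    exists ((n - S n0)%nat :: L); split.
    + intros i [Hi | [_ Hi]]; [right; apply HL | left; lia].
      assert (Hpos : 0 < / 2 ^ S n) by (apply Rinv_0_lt_compat, pow2_pos).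
      unfold powd; destruct Rle_dec; [lra |].
      apply Rle_Rpower_l; lra.
    + assert (Ht : t = / exp (s * (INR n + 1) * ln 2)).
      { unfold t, Rpower; rewrite ln_Rinv by apply pow2_pos.
        rewrite pow2_exp, ln_exp, <- exp_Ropp, S_INR; f_equal; ring. }
      set (T := exp (s * (INR n + 1) * ln 2)) in *.
      assert (HT : 1 <= T).
      { unfold T; rewrite <- exp_0 at 1; pose proof (pos_INR n).
        apply exp_le_compat; repeat apply Rmult_le_pos; lra. }
      assert (HLT : INR (length L) <= T).
      { apply (Rmult_le_reg_l t); [rewrite Ht; apply Rinv_0_lt_compat; lra |].
        rewrite Ht at 2; rewrite Rinv_l by lra; lra. }
      specialize (HN1 n ltac:(lia)).
      assert (Hsplit : 2 ^ n = exp (s * INR n * ln 2) * exp ((1 - s) * ln 2 * INR n)).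
      { rewrite pow2_exp, <- exp_plus; f_equal; ring. }
      assert (HTs : T = exp (s * INR n * ln 2) * exp (s * ln 2)).
      { unfold T; rewrite <- exp_plus; f_equal; ring. }
      cbn [length]; rewrite S_INR, Hsplit.
      pose proof (exp_pos (s * INR n * ln 2)) as He.
      apply (Rmult_le_compat_l (exp (s * INR n * ln 2))) in HN1; [| lra].
      pose proof (pow2_ge_0 (INR n)).
      apply Rle_trans with (8 * INR n ^ 2 * (2 * T)).
      * apply Rmult_le_compat_l; lra.
      * rewrite HTs; lra.
  - assert (HE : liminf_pos (fun q : nat =>
      INR q * (ln (INR q))^2 * dnint (INR q * alpha) * dnint (INR q * beta))).
    { apply (liminf_pos_of_avoiding alpha c beta n0); try assumption; [lia |].
      intros m Hm; specialize (HN2 m ltac:(lia)).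
      rewrite pow2_exp, (Rmult_comm (INR m)).
      apply (Rmult_le_compat_l (c / 12960)) in HN2; [| lra].
      replace (c / 12960 * (4 / (c / 12960) * INR m ^ 2)) with (4 * INR m ^ 2) in HN2
        by (field; lra).
      exact HN2. }
    destruct (Hcov beta HE) as [i Hi].
    destruct (proj1 (Hdiam i)) as [[Hpos | Hz] _].
    + destruct (dyadic_scale n0 (d i)) as [n [Hn Hdn]].
      { split; [exact Hpos | exact (proj2 (Hdiam i))]. }
      apply (Hb2 i n Hn); [now left | exact Hi].
    + apply (Hb2 i (S n0 + i)%nat); [lia | right; auto | exact Hi].
Qed.

(** * Upper bound for the dimension: exponents s > 1 *)

Lemma is_diam_interval (a b : R) : a <= b -> is_diam (fun x => a <= x <= b) (b - a).
Proof.
  intros Hab; split; [lra | split].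
  - intros x y Hx Hy; apply Rabs_le; lra.
  - intros e _ He; specialize (He b a ltac:(lra) ltac:(lra)).
    pose proof (Rle_abs (b - a)); lra.
Qed.

(** A discrete integral comparison: after factoring out (i + 1)^(-t), it follows from exp u >= 1 + u
    and ln ((i + 1) / i) >= 1 / (i + 1). *)
Lemma zeta_term_le (t : R) (i : nat) :
  0 < t -> (1 <= i)%nat ->
  t * Rpower (INR (S i)) (- (1 + t)) <= Rpower (INR i) (- t) - Rpower (INR (S i)) (- t).
Proof.
  intros Ht Hi.
  assert (Hi0 : 0 < INR i) by (apply lt_0_INR; lia).
  assert (HSi : 0 < INR (S i)) by (apply lt_0_INR; lia).
  set (g := Rpower (INR (S i)) (- t)).
  assert (Hg : 0 < g) by apply exp_pos.
  replace (Rpower (INR (S i)) (- (1 + t))) with (g * / INR (S i)).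
  2:{ unfold g; replace (- (1 + t)) with (- t + - (1)) by ring.
      rewrite Rpower_plus; f_equal; rewrite Rpower_Ropp, Rpower_1 by exact HSi; reflexivity. }
  replace (Rpower (INR i) (- t)) with (g * exp (t * (ln (INR (S i)) - ln (INR i)))).
  2:{ unfold g, Rpower; rewrite <- exp_plus; f_equal; ring. }
  assert (Hln : / INR (S i) <= ln (INR (S i)) - ln (INR i)).
  { pose proof (exp_ineq1_le (ln (INR i) - ln (INR (S i)))) as He.
    unfold Rminus in He; rewrite exp_plus, exp_Ropp, !exp_ln in He by assumption.
    replace (INR i * / INR (S i)) with (1 - / INR (S i)) in He; [lra |].
    rewrite S_INR in *; field; lra. }
  pose proof (exp_ineq1_le (t * (ln (INR (S i)) - ln (INR i)))) as He.
  assert (t * / INR (S i) <= exp (t * (ln (INR (S i)) - ln (INR i))) - 1) by nra.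
  nra.
Qed.

Lemma zeta_partial_sum_le (t : R) (n : nat) :
  0 < t -> sum_f_R0 (fun i => Rpower (INR (S i)) (- (1 + t))) n <= 1 + / t.
Proof.
  intros Ht.
  (* The induction needs the telescoped bound with its negative last term. *)
  assert (H : sum_f_R0 (fun i => Rpower (INR (S i)) (- (1 + t))) n
              <= 1 + / t * (1 - Rpower (INR (S n)) (- t))).
  { assert (H1 : forall z, Rpower (INR 1) z = 1).
    { intros z; unfold Rpower; change (INR 1) with 1; rewrite ln_1, Rmult_0_r; apply exp_0. }
    induction n as [| n IH]; cbn [sum_f_R0].
    - rewrite !H1; lra.
    - pose proof (zeta_term_le t (S n) Ht ltac:(lia)) as Hz.
      apply (Rmult_le_compat_l (/ t)) in Hz; [| apply Rlt_le, Rinv_0_lt_compat, Ht].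
      rewrite <- Rmult_assoc, Rinv_l, Rmult_1_l in Hz by lra.
      lra. }
  pose proof (exp_pos (- t * ln (INR (S n)))) as He; fold (Rpower (INR (S n)) (- t)) in He.
  pose proof (Rinv_0_lt_compat t Ht); nra.
Qed.

Lemma infinite_sum_of_bounded (f : nat -> R) (b : R) :
  (forall i, 0 <= f i) -> (forall n, sum_f_R0 f n <= b) ->
  exists l, infinite_sum f l /\ l <= b.
Proof.
  intros Hf Hb.
  destruct (growing_cv (sum_f_R0 f)) as [l Hl].
  - intros n; cbn [sum_f_R0]; pose proof (Hf (S n)); lra.
  - exists b; intros z [n ->]; apply Hb.
  - exists l; split; [exact Hl |].
    apply Rnot_lt_le; intros Hlt.
    destruct (Hl (l - b) ltac:(lra)) as [N HN].
    specialize (HN N (le_n N)); unfold Rdist in HN; apply Rabs_def2 in HN.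
    specialize (Hb N); lra.
Qed.

(* The line is covered by the intervals [a ln (i + 1), a ln (i + 2)] and their opposites: the
   lengths are [O(a / i)], so their [s]-th powers are summable. *)
Lemma hausdorff_null_upper (s : R) (E : R -> Prop) : 1 < s -> hausdorff_null s E.
Proof.
  intros Hs delta eps Hdelta Heps.
  set (t := s - 1).
  assert (Ht : 0 < t) by (unfold t; lra).
  set (K := 1 + / t).
  assert (HK : 0 < K) by (unfold K; pose proof (Rinv_0_lt_compat t Ht); lra).
  (* The three bounds on [2 * a] serve the mesh [delta], the estimate (2a)^s <= 2a, and the total
     [eps], as [K] bounds the zeta sum. *)
  set (a := Rmin (Rmin delta 1) (eps / K) / 2).
  assert (HeK : 0 < eps / K) by (apply Rdiv_lt_0_compat; lra).
  assert (Ha : 0 < a /\ 2 * a <= delta /\ 2 * a <= 1 /\ 2 * a <= eps / K).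
  { assert (0 < Rmin (Rmin delta 1) (eps / K)) by (repeat apply Rmin_pos; lra).
    pose proof (Rmin_l (Rmin delta 1) (eps / K)); pose proof (Rmin_r (Rmin delta 1) (eps / K)).
    pose proof (Rmin_l delta 1); pose proof (Rmin_r delta 1); unfold a; lra. }
  destruct Ha as [Ha [Had [Ha1 HaK]]].
  set (lo := fun i => a * ln (INR (S i))).
  assert (Hlo : forall i, lo i <= lo (S i)).
  { intros i; apply Rmult_le_compat_l; [lra |].
    apply Rlt_le, ln_increasing; [apply lt_0_INR; lia | apply lt_INR; lia]. }
  (* Even indices cover the nonnegative half-line, odd ones its mirror image. *)
  exists (fun n x => if Nat.even n then lo (Nat.div2 n) <= x <= lo (S (Nat.div2 n))
                     else - lo (S (Nat.div2 n)) <= x <= - lo (Nat.div2 n)).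
  exists (fun n => lo (S (Nat.div2 n)) - lo (Nat.div2 n)).
  assert (Hlen : forall n, lo (S (Nat.div2 n)) - lo (Nat.div2 n) <= 2 * a * / INR (S n)).
  { intros n; set (i := Nat.div2 n).
    assert (Hi0 : 0 < INR (S i)) by (apply lt_0_INR; lia).
    assert (Hi1 : 0 < INR (S (S i))) by (apply lt_0_INR; lia).
    assert (Hn0 : 0 < INR (S n)) by (apply lt_0_INR; lia).
    assert (Hln : ln (INR (S (S i))) - ln (INR (S i)) <= / INR (S i)).
    { pose proof (exp_ineq1_le (ln (INR (S (S i))) - ln (INR (S i)))) as He.
      unfold Rminus in He; rewrite exp_plus, exp_Ropp, !exp_ln in He by assumption.
      replace (INR (S (S i)) * / INR (S i)) with (1 + / INR (S i)) in He; [lra |].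
      rewrite (S_INR (S i)); field; lra. }
    (* As [i] is [n / 2] rounded down, [n + 1 <= 2 * (i + 1)]. *)
    assert (Hin : / INR (S i) <= 2 * / INR (S n)).
    { replace (2 * / INR (S n)) with (/ (INR (S n) / 2)) by (field; lra).
      apply Rinv_le_contravar; [lra |].
      assert (H2 : INR (S n) <= INR (2 * S i)).
      { apply le_INR; pose proof (Nat.div2_odd n); unfold i.
        destruct (Nat.odd n); simpl Nat.b2n in *; lia. }
      rewrite mult_INR in H2; simpl (INR 2) in H2; lra. }
    unfold lo; rewrite <- Rmult_minus_distr_l; fold i.
    replace (2 * a * / INR (S n)) with (a * (2 * / INR (S n))) by ring.
    apply Rmult_le_compat_l; lra. }
  split; [| split].
  - intros x _.
    assert (Hpos : forall y, 0 <= y -> exists i, lo i <= y <= lo (S i)).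
    { intros y Hy.
      destruct (INR_archimed 1 (exp (y / a)) ltac:(lra)) as [N HN].
      assert (Hya : 1 <= exp (y / a)).
      { rewrite <- exp_0; apply exp_le_compat, Rle_mult_inv_pos; lra. }
      destruct (last_step (fun i => INR (S i) <= exp (y / a)) 0 N) as [i [_ [H1 H2]]].
      - lia.
      - exact Hya.
      - rewrite !S_INR; lra.
      - exists i; apply Rnot_le_lt in H2.
        assert (Hy' : y = a * ln (exp (y / a))) by (rewrite ln_exp; field; lra).
        assert (Hi0 : 0 < INR (S i)) by (apply lt_0_INR; lia).
        unfold lo; split; rewrite Hy' at 1; apply Rmult_le_compat_l; try lra.
        + destruct H1 as [H1 | ->]; [apply Rlt_le, ln_increasing; lra | lra].
        + apply Rlt_le, ln_increasing; [apply exp_pos | lra]. }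
    destruct (Rle_lt_dec 0 x) as [Hx | Hx].
    + destruct (Hpos x Hx) as [i Hi]; exists (2 * i)%nat.
      now rewrite Nat.even_even, Nat.div2_double.
    + destruct (Hpos (- x) ltac:(lra)) as [i Hi]; exists (S (2 * i)).
      rewrite Nat.even_succ, <- Nat.negb_even, Nat.even_even, Nat.div2_succ_double; simpl negb.
      cbv iota; lra.
  - intros n; specialize (Hlo (Nat.div2 n)); specialize (Hlen n); split.
    + destruct (Nat.even n); [now apply is_diam_interval |].
      replace (lo (S (Nat.div2 n)) - lo (Nat.div2 n))
        with (- lo (Nat.div2 n) - - lo (S (Nat.div2 n))) by ring.
      apply is_diam_interval; lra.
    + assert (/ INR (S n) <= 1).
      { rewrite <- Rinv_1; apply Rinv_le_contravar; [lra |].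
        change 1 with (INR 1); apply le_INR; lia. }
      nra.
  - apply infinite_sum_of_bounded; [intros i; apply powd_ge0 |].
    intros n.
    apply Rle_trans with (2 * a * sum_f_R0 (fun i => Rpower (INR (S i)) (- (1 + t))) n).
    + rewrite scal_sum; apply sum_Rle; intros i _.
      specialize (Hlen i); specialize (Hlo (Nat.div2 i)).
      assert (HSi : 0 < INR (S i)) by (apply lt_0_INR; lia).
      unfold powd; destruct Rle_dec as [Hz | Hz].
      { apply Rmult_le_pos; [apply Rlt_le, exp_pos | lra]. }
      apply Rle_trans with (Rpower (2 * a * / INR (S i)) s).
      { apply Rle_Rpower_l; lra. }
      rewrite <- Rpower_mult_distr
        by (try apply Rinv_0_lt_compat; lra).
      replace (Rpower (/ INR (S i)) s) with (Rpower (INR (S i)) (- (1 + t))).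
      2:{ unfold Rpower, t; rewrite ln_Rinv by lra; f_equal; ring. }
      rewrite Rmult_comm; apply Rmult_le_compat_l; [apply Rlt_le, exp_pos |].
      (* [(2 a) ^ s <= 2 a] because [2 a <= 1 < s] *)
      rewrite <- (Rpower_1 (2 * a)) at 2 by lra.
      unfold Rpower; apply exp_le_compat.
      assert (ln (2 * a) <= 0).
      { rewrite <- ln_1; destruct Ha1 as [H | ->]; [apply Rlt_le, ln_increasing; lra | lra]. }
      nra.
    + pose proof (zeta_partial_sum_le t n Ht) as Hz; fold K in Hz.
      apply Rle_trans with (eps / K * K); [| right; field; lra].
      apply Rmult_le_compat; try lra.
      apply cond_pos_sum; intros i; apply Rlt_le, exp_pos.
Qed.

Theorem theorem1 (alpha : R) (Halpha : badly_approximable alpha) :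
  hausdorff_dim
    (fun beta : R =>
       liminf_pos (fun q : nat =>
         INR q * (ln (INR q))^2 * dnint (INR q * alpha) * dnint (INR q * beta)))
    1.
Proof.
  split.
  - intros s [Hs Hnull]; apply Rnot_lt_le; intros Hlt.
    exact (hausdorff_null_lower alpha s Halpha Hs Hlt Hnull).
  - intros b Hb; apply Rnot_lt_le; intros Hlt.
    (* If [b > 1], the midpoint of 1 and [b] is an admissible exponent below [b]. *)
    assert (H : b <= (1 + b) / 2).
    { apply Hb; split; [lra | apply hausdorff_null_upper; lra]. }
    lra.
Qed.
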